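(* Let $M$ be a universe (a set), and let $m,n$ be positive integers. Let $\mathcal{T}_{m,n}$ be the set of all topological spaces $(U,\tau)$ for which there is an $S_{\mathcal{MC}}$-approximation $G=(U,W,T,S)$ with $U,W\subseteq M$, $|U|=m$, $|W|=n$ and $\tau=\{\overline{G}(A)\mid A\subseteq W\}$. Then the number of equivalence classes of $\mathcal{T}_{m,n}$ under homeomorphism is $p(m,n)$, where $p(m,n)$ denotes the number of unordered partitions of $m$ into a maximum of $n$ positive integer summands, or equivalently the number of unordered partitions of $m$ into exactly $n$ non-negative integers.
   Context: For a finite set $W$, $P(W)$ denotes the set of all subsets of $W$ and $P^{\star}(W)$ the set of all non-empty subsets of $W$; $X^c=W\setminus X$ for $X\subseteq W$. An $S_{\mathcal{MC}}$-approximation is a quadruple $G=(U,W,T,S)$ where $U$ and $W$ are finite non-empty sets, and $T:U\to P^{\star}(W)$ and $S:P(W)\times P(W)\to\{0,1\}$ are maps such that: (i) ($S$-min condition) $S(A,B\cap C)=\min\{S(A,B),S(A,C)\}$ for all non-empty $A,B,C\subseteq W$; (ii) (complement condition) $S(A,B^c)=1-S(A,B)$ for all $A,B\subseteq W$; (iii) $S(A,\emptyset)=0$ for all $A\subseteq W$. For $X\subseteq W$, the upper approximation of $X$ is $\overline{G}(X)=\{x\in U\mid S(T(x),X^c)=0\}$. The family $\{\overline{G}(A)\mid A\subseteq W\}$ is a topology on $U$.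
   Formalization: The universe M is assumed to have at least max(m,n) elements (infinite M allowed); for smaller M the set of spaces is empty, so there are 0 classes while p(m,n) ≥ 1 and the claim fails. *)

(* Defs.v *)
From HB Require Import structures.
From mathcomp Require Import all_boot finmap.
From mathcomp Require Import all_classical topology.

Set Implicit Arguments.
Unset Strict Implicit.
Unset Printing Implicit Defensive.

Local Open Scope classical_set_scope.

(* [bool] plays the role of {0, 1}, through the coercion [nat_of_bool]. *)
Record SMC_approx (U W : finType) := SMCApprox {
  SMC_T : U -> {set W};
  SMC_S : {set W} -> {set W} -> bool;
  SMC_U_gt0 : (0 < #|U|)%N;
  SMC_W_gt0 : (0 < #|W|)%N;
  SMC_T_neq0 : forall x, SMC_T x != finset.set0;
  SMC_S_min : forall A B C : {set W},
    A != finset.set0 -> B != finset.set0 -> C != finset.set0 ->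
    SMC_S A (B :&: C) = minn (SMC_S A B) (SMC_S A C) :> nat;
  SMC_S_compl : forall A B : {set W},
    SMC_S A (~: B) = (1 - SMC_S A B)%N :> nat;
  SMC_S_empty : forall A : {set W}, SMC_S A finset.set0 = 0%N :> nat }.

Definition upper_approx (U W : finType) (G : SMC_approx U W) (X : {set W}) :
    set U :=
  [set x | SMC_S G (SMC_T G x) (~: X) = 0%N :> nat].

(* A topological space (U, tau) with U a finite subset of M.  The empty set is
   open by [space_bigU] applied to the empty family. *)
Record space (M : choiceType) := Space {
  carrier : {fset M};
  opens : set (set carrier);
  space_setT : opens setT;
  space_setI : forall A B, opens A -> opens B -> opens (A `&` B);
  space_bigU : forall F : set (set carrier),
    F `<=` opens -> opens (\bigcup_(A in F) A) }.

Arguments opens {M} s _.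

Definition points (M : choiceType) (X : space M) : Type := carrier X.

Section PointsTopology.
Variables (M : choiceType) (X : space M).

Let op_bigU (I : Type) (f : I -> set (points X)) :
  (forall i, opens X (f i)) -> opens X (\bigcup_i f i).
Proof.
move=> fO; rewrite -(bigcup_image setT f id).
by apply: space_bigU => _ [i _ <-].
Qed.

HB.instance Definition _ := Choice.copy (points X) (carrier X).

HB.instance Definition _ := isOpenTopological.Build (points X)
  (@space_setT M X) (@space_setI M X) op_bigU.

Lemma open_points (A : set (points X)) : open A <-> opens X A.
Proof. by []. Qed.

End PointsTopology.

Definition homeomorphic (M : choiceType) (X Y : space M) : Prop :=
  exists (f : points X -> points Y) (g : points Y -> points X),
    [/\ cancel f g, cancel g f, continuous f & continuous g].

Definition SMC_spaces (M : choiceType) (m n : nat) : set (space M) :=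
  [set X | #|` carrier X| = m /\
    exists W : {fset M}, #|` W| = n /\
    exists G : SMC_approx (carrier X) W, opens X = range (upper_approx G)].

Arguments SMC_spaces M m n : clear implicits.

Definition homeomorphism_classes (M : choiceType) (T : set (space M)) :
    set (set (space M)) :=
  [set [set Y | T Y /\ homeomorphic X Y] | X in T].

(* Unordered partitions are represented by weakly decreasing sequences; taking
   the parts in ['I_m.+1] is harmless, since no part exceeds the sum m. *)
Definition num_partitions_pos (m n : nat) : nat :=
  (\sum_(k < n.+1) #|[pred t : k.-tuple 'I_m.+1 |
     let s := [seq val i | i <- t] in
     [&& sorted geq s, all (ltn 0) s & sumn s == m]]|)%N.

Definition num_partitions_nneg (m n : nat) : nat :=
  #|[pred t : n.-tuple 'I_m.+1 |
     let s := [seq val i | i <- t] in sorted geq s && (sumn s == m)]|.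

(* Main.v *)
Require Import Defs.
From mathcomp Require Import all_boot finmap.
From mathcomp Require Import all_classical topology.

(** For a non-empty [A], the sets [B] with [S(A, B) = 1] form an ultrafilter on
the finite set [W]: they are stable under intersection, and exactly one of [B]
and its complement is among them.  Such an ultrafilter is principal, so [S(A, -)]
is membership of a point [w(A)] (lemma [SMC_principal]).  With
[f(x) = w(T(x))], the upper approximation of [A] is the preimage of [A] under
[f], hence the topology of [G] consists of the unions of fibres of [f : U -> W]
([upper_approx_saturated]).  Conversely every map [f : U -> W] is obtained, from
[T(x) = {f(x)}] ([saturated_upper_approx]).

So the spaces to be classified are the partition topologies on [m] points whose
blocks are the fibres of a map to [n] points, and empty fibres are permitted.
Two such spaces are homeomorphic if and only if a bijection between their points
respects the relation of lying in one block ([homeomorphic_saturatedP]).  Among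
maps to targets of the same size [n], this happens if and only if the sequences
of the [n] fibre sizes agree up to order ([perm_fiber_sizesP]).  Sorting the
fibre sizes is therefore a complete invariant of homeomorphism, with values in
the weakly decreasing sequences of [n] naturals of sum [m]; every such sequence
is a sequence of fibre sizes ([exists_fiber_sizes]), and the finite sets that are
required exist inside [M] because [M] has at least [max(m, n)] elements.

The two ways of counting partitions agree because a weakly decreasing sequence
is its positive part followed by zeros, and the number of positive terms of a
sequence of length [n] is some [k <= n]. *)

Set Implicit Arguments.
Unset Strict Implicit.
Unset Printing Implicit Defensive.

Local Open Scope classical_set_scope.
Local Open Scope card_scope.

(** * Weakly decreasing sequences and their zeros *)

Lemma geq_trans : transitive geq.
Proof. by move=> y x z /= yx zy; apply: leq_trans zy yx. Qed.

Lemma geq_anti : antisymmetric geq.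
Proof. by move=> x y /=; rewrite andbC => /anti_leq. Qed.

Lemma filter_pos_sorted (s : seq nat) : sorted geq s ->
  sorted geq [seq x <- s | (0 < x)%N].
Proof. exact: (sorted_filter geq_trans). Qed.

Lemma sorted_pad (s : seq nat) k : sorted geq s -> sorted geq (s ++ nseq k 0).
Proof.
rewrite !sorted_pairwise; try exact: geq_trans.
rewrite pairwise_cat => ->; apply/and3P; split=> //.
- by apply/allrelP => x y _ /nseqP[-> _].
- by elim: k => //= k ->; rewrite andbT; apply/allP => x /nseqP[->].
Qed.

Lemma perm_pad_pos (s : seq nat) :
  perm_eq s ([seq x <- s | (0 < x)%N] ++ nseq (size s - count (ltn 0) s) 0).
Proof.
have e : [seq x <- s | ~~ (0 < x)%N] = nseq (size s - count (ltn 0) s) 0.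
  rewrite -(count_predC (ltn 0) s) addKn.
  by elim: s => //= -[|x] s IHs /=; rewrite IHs.
by rewrite -e perm_sym (perm_filterC (ltn 0)).
Qed.

Lemma sorted_pad_pos (s : seq nat) : sorted geq s ->
  s = [seq x <- s | (0 < x)%N] ++ nseq (size s - count (ltn 0) s) 0.
Proof.
move=> s_sorted; apply: (sorted_eq geq_trans geq_anti) => //.
  exact/sorted_pad/filter_pos_sorted.
exact: perm_pad_pos.
Qed.

(** For sequences of equal length the multiplicity of [0] is determined by the
other multiplicities.  This matters because empty fibres leave no trace in the
space, so that only positive multiplicities can be read off from it. *)
Lemma perm_eq_pos_count (s t : seq nat) : size s = size t ->
  (forall j, (0 < j)%N -> count_mem j s = count_mem j t) -> perm_eq s t.
Proof.
move=> st cst.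
have pos_st : perm_eq [seq x <- s | (0 < x)%N] [seq x <- t | (0 < x)%N].
  apply/allP => j _ /=; rewrite !count_filter.
  case: (posnP j) => [->|j_gt0].
    by rewrite !(@eq_count _ _ pred0) ?count_pred0 // => -[].
  have e : predI (pred1 j) (fun x => (0 < x)%N) =1 pred1 j.
    by move=> x /=; case: eqP => // ->.
  by rewrite !(eq_count e) cst.
apply: perm_trans (perm_pad_pos s) _.
rewrite perm_sym; apply: perm_trans (perm_pad_pos t) _.
have /eqP -> : count (ltn 0) s == count (ltn 0) t.
  by rewrite -!size_filter (perm_size pos_st).
by rewrite st perm_sym perm_cat2r.
Qed.

(** Sequences of length [n] are sorted by their number [k] of positive terms; for
fixed [k], appending [n - k] zeros is a bijection from the positive sequences of
length [k]. *)
Lemma num_partitions_pos_nneg (m n : nat) :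
  num_partitions_pos m n = num_partitions_nneg m n.
Proof.
rewrite /num_partitions_nneg -sum1_card.
pose parts k (t : k.-tuple 'I_m.+1) := [seq val i | i <- t].
have parts_inj k : injective (parts k).
  by move=> t u /(inj_map val_inj) /val_inj.
pose npos (t : n.-tuple 'I_m.+1) : 'I_n.+1 := inord (count (ltn 0) (parts n t)).
have val_npos t : npos t = count (ltn 0) (parts n t) :> nat.
  by rewrite inordK // ltnS (leq_trans (count_size _ _)) // size_map size_tuple.
rewrite (partition_big npos predT) //= /num_partitions_pos.
apply: eq_bigr => k _; rewrite sum1_card.
have k_le_n : (k <= n)%N by rewrite -ltnS.
pose pad (t : k.-tuple 'I_m.+1) : n.-tuple 'I_m.+1 :=
  tcast (subnKC k_le_n) [tuple of t ++ nseq (n - k) ord0].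
have parts_pad t : parts n (pad t) = parts k t ++ nseq (n - k) 0.
  by rewrite /parts /pad val_tcast /= map_cat map_nseq.
have pad_inj : injective pad.
  move=> t u /(congr1 (parts n)) /eqP; rewrite !parts_pad.
  rewrite eqseq_cat ?size_map ?size_tuple // => /andP[/eqP tu _].
  exact: parts_inj tu.
rewrite -(fintype.card_image pad_inj); apply: eq_card => u.
apply/fintype.imageP/idP => /= [[t]|/andP[/andP[u_sorted u_sum] /eqP u_k]].
  rewrite inE => /and3P[t_sorted t_pos t_sum] ->.
  have size_t : count (ltn 0) (parts k t) = k.
    by rewrite -size_filter (all_filterP t_pos) size_map size_tuple.
  apply/andP; split; last first.
    apply/eqP/val_inj; rewrite /= val_npos parts_pad count_cat size_t.
    by rewrite count_nseq mul0n addn0.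
  rewrite inE -[[seq _ | _ <- _]]/(parts n (pad t)) parts_pad sorted_pad //.
  by rewrite sumn_cat sumn_nseq mul0n addn0.
have u_k' : count (ltn 0) (parts n u) = k by rewrite -val_npos u_k.
pose v := [seq i : 'I_m.+1 <- u | (0 < i)%N].
have v_size : size v == k by rewrite size_filter -u_k' /parts count_map.
have v_parts : parts k (Tuple v_size) = [seq x <- parts n u | (0 < x)%N].
  by rewrite /parts /= filter_map.
have u_parts : parts n u = parts k (Tuple v_size) ++ nseq (n - k) 0.
  by rewrite {1}(@sorted_pad_pos (parts n u)) // v_parts u_k' size_map size_tuple.
exists (Tuple v_size); last by apply: parts_inj; rewrite parts_pad.
rewrite inE -[[seq _ | _ <- _]]/(parts k (Tuple v_size)).
apply/and3P; split.
- by rewrite v_parts; apply: filter_pos_sorted.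
- by rewrite v_parts filter_all.
- move: u_sum; rewrite -[[seq _ | _ <- u]]/(parts n u) u_parts.
  by rewrite sumn_cat sumn_nseq mul0n addn0.
Qed.

(** * Fibre sizes of a map between finite sets *)

Definition fiber_sizes (U W : finType) (f : U -> W) : seq nat :=
  [seq #|[pred x | f x == w]| | w <- enum W].

Lemma size_fiber_sizes (U W : finType) (f : U -> W) :
  size (fiber_sizes f) = #|W|.
Proof. by rewrite size_map cardE. Qed.

Lemma sumn_fiber_sizes (U W : finType) (f : U -> W) :
  sumn (fiber_sizes f) = #|U|.
Proof.
rewrite sumnE big_map big_enum -[RHS]sum1_card /=.
rewrite (partition_big f predT) //=.
by apply: eq_bigr => w _; rewrite sum1_card.
Qed.

(** The bijection sends the element of rank [r] in the enumeration of a fibre of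
[f] to the element of rank [r] in the corresponding fibre of [f']; the inverse is
the same construction with [f] and [f'] exchanged. *)
Lemma fiberwise_bijection (U U' : finType) (I : eqType)
    (f : U -> I) (f' : U' -> I) :
  (forall i, #|[pred x | f x == i]| = #|[pred y | f' y == i]|) ->
  exists (h : U -> U') (k : U' -> U),
    [/\ cancel h k, cancel k h & forall x, f' (h x) = f x].
Proof.
move=> ff'.
case: (pickP (@predT U)) => [d _|U0]; last first.
  have U'0 (y : U') : False.
    have : (0 < #|[pred z | f' z == f' y]|)%N.
      by apply/card_gt0P; exists y; rewrite inE.
    by rewrite -ff' => /card_gt0P[x _]; have := U0 x.
  have U'' (x : U) : False by have := U0 x.
  exists (fun x => False_rect U' (U'' x)), (fun y => False_rect U (U'0 y)).
  by split=> [x|y|x]; [case: (U'' x)|case: (U'0 y)|case: (U'' x)].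
have [d' _] : exists d' : U', d' \in [pred y | f' y == f d].
  by apply/card_gt0P; rewrite -ff'; apply/card_gt0P; exists d; rewrite inE.
pose transport (V V' : finType) (e : V') (g : V -> I) (g' : V' -> I) x :=
  nth e (enum [pred y | g' y == g x]) (index x (enum [pred z | g z == g x])).
have transportP (V V' : finType) e e' (g : V -> I) (g' : V' -> I) :
    (forall i, #|[pred x | g x == i]| = #|[pred y | g' y == i]|) ->
  forall x, g' (transport V V' e g g' x) = g x /\
    transport V' V e' g' g (transport V V' e g g' x) = x.
  move=> gg' x.
  have idx : (index x (enum [pred z | g z == g x])
      < size (enum [pred y | g' y == g x]))%N.
    by rewrite -cardE -gg' cardE index_mem mem_enum inE.
  have gt : g' (transport V V' e g g' x) = g x.
    by have := mem_nth e idx; rewrite mem_enum inE => /eqP.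
  split=> //; rewrite {1}/transport gt index_uniq ?enum_uniq //.
  by rewrite nth_index // mem_enum inE.
exists (transport _ _ d' f f'), (transport _ _ d f' f); split=> x.
- by have [] := transportP _ _ d' d f f' ff' x.
- by have [] := transportP _ _ d d' f' f (fun i => esym (ff' i)) x.
- by have [] := transportP _ _ d' d f f' ff' x.
Qed.

Lemma count_fiber_sizes (U W : finType) (f : U -> W) (j : nat) :
  count_mem j (fiber_sizes f) = #|[pred w | #|[pred x | f x == w]| == j]|.
Proof.
by rewrite count_map cardE -(size_filter (fun w => #|[pred x | f x == w]| == j)) enumT.
Qed.

(** The left-hand side speaks only of the relation [f x = f y], so for [j > 0] the
multiplicity of [j] among the fibre sizes depends on that relation alone. *)
Lemma card_in_fiber_of_size (U W : finType) (f : U -> W) (j : nat) :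
  #|[pred x | #|[pred y | f y == f x]| == j]|
  = (count_mem j (fiber_sizes f) * j)%N.
Proof.
rewrite count_fiber_sizes -sum_nat_const -sum1_card.
rewrite (partition_big f [pred w | #|[pred x | f x == w]| == j]) //=.
apply: eq_bigr => w /eqP wj; rewrite sum1_card -[RHS]wj.
apply: eq_card => x; rewrite [LHS]unfold_in [RHS]unfold_in /= andbC.
by case: (f x =P w) => // fxw; rewrite inE fxw wj eqxx.
Qed.

(** The sizes of the fibres determine the partition into fibres up to a bijection:
[fiberwise_bijection], applied to the two maps that send a point of the target to
its fibre size, gives a bijection [s] of the targets that preserves fibre sizes;
applied again, to [s \o f] and [f'], it gives the bijection of the sources.  The
converse counts the elements that lie in a fibre of given positive size. *)
Lemma perm_fiber_sizesP (U U' W W' : finType) (f : U -> W) (f' : U' -> W') :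
  #|W| = #|W'| ->
  perm_eq (fiber_sizes f) (fiber_sizes f') <->
  exists (h : U -> U') (k : U' -> U),
    [/\ cancel h k, cancel k h & forall x y, f x = f y <-> f' (h x) = f' (h y)].
Proof.
move=> WW'; split=> [pff'|[h [k [hK kH hf]]]].
  have [|s [s' [sK s'K sE]]] := @fiberwise_bijection W W' nat
    (fun w => #|[pred x | f x == w]|) (fun w => #|[pred x | f' x == w]|).
    by move=> j; rewrite -!count_fiber_sizes; apply/permP.
  have [|h [k [hK kH hE]]] := @fiberwise_bijection U U' W' (s \o f) f'.
    move=> w'; rewrite -{2}(s'K w') sE; apply: eq_card => x.
    by rewrite !inE /= (can2_eq sK s'K).
  exists h, k; split=> // x y; rewrite !hE /=.
  by split=> [->|/(can_inj sK)].
apply: perm_eq_pos_count => [|j j_gt0]; first by rewrite !size_fiber_sizes.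
apply/eqP; rewrite -(eqn_pmul2r j_gt0) -!card_in_fiber_of_size; apply/eqP.
have card_h (P : pred U') : #|[pred x | P (h x)]| = #|P|.
  rewrite -(fintype.card_image (can_inj hK)); apply: eq_card => y.
  apply/fintype.imageP/idP => [[x Px ->]|Py]; first exact: Px.
  by exists (k y); rewrite ?inE kH.
rewrite -card_h; apply: eq_card => x; rewrite !inE -card_h.
congr (_ == j); apply: eq_card => y; rewrite !inE.
by apply/eqP/eqP => /hf.
Qed.

(** The projection of the disjoint union of sets of the prescribed sizes has these
fibre sizes, and [U] is in bijection with this union. *)
Lemma exists_fiber_sizes (U W : finType) (s : seq nat) :
  size s = #|W| -> sumn s = #|U| -> exists f : U -> W, fiber_sizes f = s.
Proof.
move=> sW sU; pose c (w : W) := nth 0 s (enum_rank w).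
have cs : [seq c w | w <- enum W] = s.
  apply: (@eq_from_nth _ 0); first by rewrite size_map -cardE.
  move=> i; rewrite size_map -cardE => iW.
  rewrite (nth_map (enum_val (Ordinal iW))) -?cardE // /c.
  by rewrite -(enum_val_nth _ (Ordinal iW)) enum_valK.
(* [c w] is the size prescribed for the fibre over [w]. *)
pose V := {: {w : W & 'I_(c w)}}.
have UV : #|U| = #|V|.
  rewrite card_tagged -sU -{1}cs; congr sumn.
  by apply: eq_map => w; rewrite card_ord.
exists (fun x => tag (enum_val (cast_ord UV (enum_rank x)))).
rewrite -[RHS]cs; apply: eq_map => w.
pose e (x : U) : V := enum_val (cast_ord UV (enum_rank x)).
have e_inj : injective e.
  by move=> x y /enum_val_inj /cast_ord_inj /enum_rank_inj.
have eK v : exists x, e x = v.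
  exists (enum_val (cast_ord (esym UV) (enum_rank v))).
  by rewrite /e enum_valK cast_ordKV enum_rankK.
rewrite -(card_ord (c w)) (bij_eq_card (@tag_with_bij _ (fun w => 'I_(c w)) w)) card_sub.
rewrite -(fintype.card_image e_inj); apply: eq_card => v.
apply/fintype.imageP/idP => [[x xw ->]|vw]; first exact: xw.
by have [x xv] := eK v; exists x; rewrite // inE -/(e x) xv.
Qed.

(** * Approximations and the maps they come from *)

(** The unions of fibres of [f], that is, the preimages of subsets of [I]. *)
Definition saturated_sets (U I : Type) (f : U -> I) : set (set U) :=
  [set O | forall x y, f x = f y -> O x -> O y].

(** If no singleton were in [F], all complements of singletons would be, and so
would their intersection, which is empty. *)
Lemma ultrafilter_principal (W : finType) (F : {set W} -> bool) :
  F finset.set0 = false ->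
  (forall A B, F (A :&: B)%SET = F A && F B) ->
  (forall A, F (~: A)%SET = ~~ F A) ->
  exists w, forall A, F A = (w \in A).
Proof.
move=> F0 FI FC.
have FT : F (finset.setT) = true by rewrite -finset.setC0 FC F0.
have [w Fw] : exists w, F [set w]%SET.
  apply/existsP; apply: contraFT F0; rewrite negb_exists => /forallP nF.
  have -> : finset.set0 = (\bigcap_w ~: [set w])%SET :> {set W}.
    apply/setP => w; rewrite inE; apply/esym/negbTE/bigcapP => /(_ w isT).
    by rewrite !inE eqxx.
  rewrite (big_morph F FI FT) big_andE; apply/forallP => w /=.
  by rewrite FC.
have Fsub (A : {set W}) : w \in A -> F A.
  move=> wA; have : F ([set w] :&: A)%SET by rewrite (finset.setIidPl _) ?finset.sub1set.
  by rewrite FI => /andP[].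
exists w => A; apply/idP/idP => [FA|]; last exact: Fsub.
by apply: contraTT FA => wA; rewrite -FC Fsub // inE.
Qed.

Section SMC.
Variables (U W : finType).

(** The S-min condition is only assumed for non-empty sets, but extends to empty
ones, since [S(A, -)] vanishes on the empty set. *)
Lemma SMC_principal (G : SMC_approx U W) (A : {set W}) : A != finset.set0 ->
  exists w, forall B, SMC_S G A B = (w \in B).
Proof.
move=> A0.
have S0 : SMC_S G A finset.set0 = false.
  by have := SMC_S_empty G A; case: (SMC_S _ _ _).
apply: ultrafilter_principal => // [B C|B].
- have [->|B0] := eqVneq B finset.set0; first by rewrite finset.set0I S0.
  have [->|C0] := eqVneq C finset.set0.
    by rewrite finset.setI0 S0 andbF.
  by have := SMC_S_min G A0 B0 C0; do 3!case: (SMC_S G A _).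
- by have := SMC_S_compl G A B; do 2!case: (SMC_S G A _).
Qed.

Lemma range_preimset (f : U -> W) (upper : {set W} -> set U) :
  (forall A x, upper A x <-> f x \in A) -> range upper = saturated_sets f.
Proof.
move=> upperE; apply/seteqP; split=> [_ [A _ <-] x y xy|O Osat].
  by rewrite !upperE xy.
exists [set w | `[< exists2 x, f x = w & O x >]]%SET => //.
apply/seteqP; split=> x.
  by move/upperE; rewrite inE => /asboolP[y yx Oy]; apply: Osat Oy.
by move=> Ox; apply/upperE; rewrite inE; apply/asboolP; exists x.
Qed.

Lemma upper_approx_saturated (G : SMC_approx U W) :
  exists f : U -> W, range (upper_approx G) = saturated_sets f.
Proof.
have [f fP] := fin_all_exists (fun x => SMC_principal G (SMC_T_neq0 G x)).
exists f; apply: range_preimset => A x.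
rewrite /upper_approx /= fP inE.
by case: (f x \in A); split.
Qed.

(** Any choice of a point [w(A)] in each non-empty [A] gives a valid [S]; since
[w({f(x)}) = f(x)], taking [T(x) = {f(x)}] recovers [f]. *)
Lemma saturated_upper_approx (f : U -> W) :
  (0 < #|U|)%N -> (0 < #|W|)%N ->
  exists G : SMC_approx U W, range (upper_approx G) = saturated_sets f.
Proof.
move=> U0 W0; have /card_gt0P[w0 _] := W0.
pose point (A : {set W}) := odflt w0 [pick w in A].
have T0 x : [set f x]%SET != finset.set0.
  by apply/set0Pn; exists (f x); rewrite inE.
have S_min (A B C : {set W}) : A != finset.set0 -> B != finset.set0 ->
    C != finset.set0 ->
    (point A \in (B :&: C)%SET) = minn (point A \in B) (point A \in C) :> nat.
  by move=> _ _ _; rewrite inE; do 2!case: (point A \in _).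
have S_compl (A B : {set W}) :
    (point A \in (~: B)%SET) = (1 - (point A \in B))%N :> nat.
  by rewrite inE; case: (point A \in _).
have S_empty (A : {set W}) : (point A \in finset.set0) = 0 :> nat.
  by rewrite inE.
exists (SMCApprox U0 W0 T0 S_min S_compl S_empty); apply: range_preimset => A x.
rewrite /upper_approx /= inE.
have -> : point [set f x]%SET = f x.
  rewrite /point; case: pickP => [w|/(_ (f x))]; last by rewrite inE eqxx.
  by rewrite inE => /eqP.
by case: (f x \in A); split.
Qed.

End SMC.

(** * Partition topologies and their block sizes *)

Section Spaces.
Variable M : choiceType.
Implicit Types X Y Z : space M.

Lemma SMC_spacesP (m n : nat) X : (0 < m)%N -> (0 < n)%N ->
  SMC_spaces M m n X <->
  #|` carrier X| = m /\ exists W : {fset M}, #|` W| = n /\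
    exists f : carrier X -> W, opens X = saturated_sets f.
Proof.
move=> m_gt0 n_gt0; split=> -[Xm [W [Wn [G XG]]]]; split=> //;
    exists W; split=> //.
  by have [f fG] := upper_approx_saturated G; exists f; rewrite XG.
have [||H HG] := @saturated_upper_approx (carrier X) W G.
- by rewrite -cardfE Xm.
- by rewrite -cardfE Wn.
- by exists H; rewrite XG.
Qed.

Section FiberSpace.
Variables (C : {fset M}) (I : Type) (f : C -> I).

Lemma saturated_setT : saturated_sets f setT.
Proof. by []. Qed.

Lemma saturated_setI A B : saturated_sets f A -> saturated_sets f B ->
  saturated_sets f (A `&` B).
Proof.
by move=> fA fB x y xy [Ax Bx]; split; [apply: fA Ax|apply: fB Bx].
Qed.

Lemma saturated_bigU F : F `<=` saturated_sets f ->
  saturated_sets f (\bigcup_(A in F) A).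
Proof. by move=> Ff x y xy [A FA Ax]; exists A => //; apply: Ff FA _ _ xy Ax. Qed.

Definition fiber_space : space M :=
  Space saturated_setT saturated_setI saturated_bigU.

End FiberSpace.

(** For the direct implication, the preimage of the open set of all [z] with
[g z = g (h x)] contains [x], hence every point of the block of [x]. *)
Lemma continuous_saturatedP X Y (I J : Type) (f : carrier X -> I)
    (g : carrier Y -> J) (h : points X -> points Y) :
  opens X = saturated_sets f -> opens Y = saturated_sets g ->
  continuous h <-> (forall x y, f x = f y -> g (h x) = g (h y)).
Proof.
move=> Xf Yg; rewrite continuousP; split=> [h_cont x y xy|hfg O].
  have : open ([set z | g z = g (h x)] : set (points Y)).
    by apply/open_points; rewrite Yg => a b ab /= <-.
  move/h_cont/open_points; rewrite Xf => /(_ x y xy) /= -> //.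
move=> /open_points; rewrite Yg => Osat; apply/open_points; rewrite Xf.
by move=> x y xy /=; apply: Osat; apply: hfg.
Qed.

Lemma homeomorphic_saturatedP X Y (I J : Type) (f : carrier X -> I)
    (g : carrier Y -> J) :
  opens X = saturated_sets f -> opens Y = saturated_sets g ->
  homeomorphic X Y <->
  exists (h : carrier X -> carrier Y) (k : carrier Y -> carrier X),
    [/\ cancel h k, cancel k h & forall x y, f x = f y <-> g (h x) = g (h y)].
Proof.
move=> Xf Yg; split=> -[h [k]].
  move=> [hK kH /(continuous_saturatedP _ Xf Yg) hc].
  move=> /(continuous_saturatedP _ Yg Xf) kc.
  exists h, k; split=> // x y; split=> [|/kc]; first exact: hc.
  by rewrite !hK.
move=> [hK kH hE]; exists h, k; split=> //.
  by apply/(continuous_saturatedP _ Xf Yg) => x y /hE.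
by apply/(continuous_saturatedP _ Yg Xf) => x y xy; apply/hE; rewrite !kH.
Qed.

Lemma homeomorphic_refl X : homeomorphic X X.
Proof. by exists id, id; split=> // x; apply: cvg_id. Qed.

Lemma homeomorphic_sym X Y : homeomorphic X Y -> homeomorphic Y X.
Proof. by move=> [f [g [fK gK fc gc]]]; exists g, f; split. Qed.

Lemma homeomorphic_trans X Y Z :
  homeomorphic X Y -> homeomorphic Y Z -> homeomorphic X Z.
Proof.
move=> [f [g [fK gK fc gc]]] [f' [g' [fK' gK' fc' gc']]].
exists (f' \o f), (g \o g'); split; try exact: can_comp.
- by move=> x; apply: continuous_comp; [apply: fc|apply: fc'].
- by move=> x; apply: continuous_comp; [apply: gc'|apply: gc].
Qed.

(** The zeros of [s] stand for points of [W] that no point of [X] is mapped to, so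
[s] is determined by [X] up to order only once its length is fixed. *)
Definition has_block_sizes (s : seq nat) X :=
  exists (W : finType) (f : carrier X -> W),
    opens X = saturated_sets f /\ perm_eq s (fiber_sizes f).

Lemma homeomorphic_block_sizes (s t : seq nat) X Y : size s = size t ->
  has_block_sizes s X -> has_block_sizes t Y ->
  homeomorphic X Y <-> perm_eq s t.
Proof.
move=> st [W [f [Xf sf]]] [W' [g [Yg tg]]].
have WW' : #|W| = #|W'|.
  by rewrite -(size_fiber_sizes f) -(size_fiber_sizes g) -(perm_size sf) st
    (perm_size tg).
rewrite (homeomorphic_saturatedP Xf Yg) -(perm_fiber_sizesP f g WW').
by rewrite -(permPl sf) -(permPr tg).
Qed.

Lemma exists_subfset (A : {fset M}) k : (k <= #|` A|)%N ->
  exists B : {fset M}, #|` B| = k.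
Proof.
move=> kA; exists [fset x in take k (enum_fset A)]%fset.
by rewrite card_fseq undup_id ?take_uniq ?fset_uniq // size_takel.
Qed.

Lemma exists_block_sizes (s : seq nat) (A : {fset M}) :
  (0 < size s)%N -> (0 < sumn s)%N -> (maxn (sumn s) (size s) <= #|` A|)%N ->
  exists2 X, SMC_spaces M (sumn s) (size s) X & has_block_sizes s X.
Proof.
move=> s0 m0; rewrite geq_max => /andP[/exists_subfset[C Cm] /exists_subfset[W Wn]].
have [||f fs] := @exists_fiber_sizes C W s; try by rewrite -cardfE ?Cm ?Wn.
exists (fiber_space f); last by exists W, f; rewrite fs.
apply/SMC_spacesP => //; split=> //.
by exists W; split=> //; exists f.
Qed.

Lemma SMC_spaces_block_sizes (m n : nat) X : (0 < m)%N -> (0 < n)%N ->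
  SMC_spaces M m n X ->
  exists s, [/\ size s = n, sumn s = m, sorted geq s & has_block_sizes s X].
Proof.
move=> m0 n0 /SMC_spacesP[] // Xm [W [Wn [f Xf]]].
have sE : perm_eq (sort geq (fiber_sizes f)) (fiber_sizes f).
  exact: permEl (perm_sort _ _).
exists (sort geq (fiber_sizes f)); split.
- by rewrite size_sort size_fiber_sizes -cardfE.
- by rewrite (perm_sumn sE) sumn_fiber_sizes -cardfE.
- by apply: sort_sorted => x y; apply: leq_total.
- by exists W, f.
Qed.

End Spaces.

(** * Counting homeomorphism classes *)

Unset Implicit Arguments.

Theorem theorem5p7 (M : choiceType) (m n : nat)
    (M_large : exists A : {fset M}, (maxn m n <= #|` A|)%N)
    (m_gt0 : (0 < m)%N) (n_gt0 : (0 < n)%N) :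
  (homeomorphism_classes (SMC_spaces M m n) #= `I_(num_partitions_pos m n)) /\
  num_partitions_pos m n = num_partitions_nneg m n.
Proof.
split; last exact: num_partitions_pos_nneg.
rewrite num_partitions_pos_nneg /num_partitions_nneg.
set P := [pred t : n.-tuple 'I_m.+1 | _].
pose parts (t : n.-tuple 'I_m.+1) := [seq val i | i <- t].
have size_parts t : size (parts t) = n by rewrite size_map size_tuple.
have rep_exists (i : 'I_#|P|) :
    exists X, SMC_spaces M m n X /\ has_block_sizes (parts (enum_val i)) X.
  have /andP[_ /eqP sum_i] : P (enum_val i) := enum_valP i.
  have [A A_large] := M_large.
  have [|||X] := @exists_block_sizes M (parts (enum_val i)) A;
    rewrite ?size_parts ?sum_i //.
  by exists X.
have [rep repP] := choice rep_exists.
have parts_eq i j :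
    perm_eq (parts (enum_val i)) (parts (enum_val j)) -> i = j :> 'I_#|P|.
  have /andP[si _] : P (enum_val i) := enum_valP i.
  have /andP[sj _] : P (enum_val j) := enum_valP j.
  move=> /(sorted_eq geq_trans geq_anti si sj) /(inj_map val_inj) /val_inj.
  exact: enum_val_inj.
pose class X := [set Y | SMC_spaces M m n Y /\ homeomorphic X Y].
have class_eq X Y : homeomorphic X Y -> class X = class Y.
  move=> XY; apply/seteqP; split=> Z [TZ XZ]; split=> //.
    by apply: homeomorphic_trans XZ; apply: homeomorphic_sym.
  by apply: homeomorphic_trans XZ.
(* The class of [X] is represented by the sorted block sizes of [X]; each is at
   most their sum [m], so they fit in ['I_m.+1]. *)
have classes_rep :
    homeomorphism_classes (SMC_spaces M m n) = range (class \o rep).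
  apply/seteqP; split=> [_ [X TX <-]|_ [i _ <-]]; last first.
    by exists (rep i) => //; have [] := repP i.
  have [s [sn sm s_sorted sX]] := SMC_spaces_block_sizes m_gt0 n_gt0 TX.
  have s_le x : x \in s -> (x < m.+1)%N.
    by rewrite ltnS -sm => /(perm_to_rem)/perm_sumn ->; apply: leq_addr.
  have t_size : size [seq inord x : 'I_m.+1 | x <- s] == n.
    by rewrite size_map sn.
  have t_parts : parts (Tuple t_size) = s.
    rewrite /parts /= -map_comp -[RHS]map_id; apply/eq_in_map => x /s_le xm /=.
    by rewrite inordK.
  have tP : Tuple t_size \in P.
    by rewrite inE -[[seq _ | _ <- _]]/(parts _) t_parts s_sorted sm /=.
  exists (enum_rank_in tP (Tuple t_size)) => //=; apply: class_eq.
  have [_ sizes_rep] := repP (enum_rank_in tP (Tuple t_size)).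
  apply/(homeomorphic_block_sizes _ sizes_rep sX).
    by rewrite size_parts sn.
  by rewrite enum_rankK_in // t_parts.
rewrite classes_rep.
have class_rep_inj : {in setT &, injective (class \o rep)}.
  move=> i j _ _ /= ij; apply: parts_eq.
  have [_ sizes_i] := repP i; have [Tj sizes_j] := repP j.
  apply/(homeomorphic_block_sizes _ sizes_i sizes_j).
    by rewrite !size_parts.
  suff [] : class (rep i) (rep j) by [].
  by rewrite ij; split=> //; apply: homeomorphic_refl.
apply: card_eq_trans (inj_card_eq class_rep_inj) _.
by rewrite card_eq_sym; apply: card_II.
Qed.
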